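(* If $\mathcal X$ is a finite dimensional linear space over the field $\mathbb K$ of real or complex numbers, then $\mathcal N(\mathcal X)\setminus\{O\}$ has a basis.
   Context: $\mathcal N(\mathcal X)$ is the set of all norms on $\mathcal X$ together with the zero function $O$, with pointwise addition, $(\alpha f)(x)=|\alpha|f(x)$ for $\alpha\in\mathbb K$, and $f\le g$ iff $f(x)\le g(x)$ for all $x\in\mathcal X$; its set of minimal elements is $\{O\}$. For $f\in\mathcal N(\mathcal X)\setminus\{O\}$, $L(f):=\{g\in\mathcal N(\mathcal X):g\ge\alpha f\text{ for some }\alpha\in\mathbb K\setminus\{0\}\}$. Two elements $f,g\in\mathcal N(\mathcal X)\setminus\{O\}$ are orderly independent if neither $f\in L(g)$ nor $g\in L(f)$; a subset is orderly independent if any two distinct members of it are orderly independent. A subset $B\subseteq\mathcal N(\mathcal X)\setminus\{O\}$ is a generator of $\mathcal N(\mathcal X)\setminus\{O\}$ if $\mathcal N(\mathcal X)\setminus\{O\}=\bigcup_{f\in B}L(f)$, and a basis if it is an orderly independent generator. *)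

(* Defs.v *)
From mathcomp Require Import all_boot all_order all_algebra.
From mathcomp Require Import complex.
From mathcomp Require Import all_classical all_reals.

Set Implicit Arguments.
Unset Strict Implicit.
Unset Printing Implicit Defensive.

Import Order.TTheory GRing.Theory Num.Theory.

Local Open Scope classical_set_scope.
Local Open Scope ring_scope.

Variant scalar_kind := RealScalars | ComplexScalars.

Definition scalar_field (R : realType) (k : scalar_kind) : numFieldType :=
  match k with
  | RealScalars => R : numFieldType
  | ComplexScalars => R[i] : numFieldType
  end.

(* The library norm on R[i] takes its values in R[i]; [Normc.normc] is the
   R-valued modulus, so that norms below are R-valued for both fields. *)
Definition modulus (R : realType) (k : scalar_kind) : scalar_field R k -> R :=
  match k return scalar_field R k -> R with
  | RealScalars => fun a : R => `|a|
  | ComplexScalars => fun a : R[i] => Normc.normc a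
  end.

Section NormCone.
Variables (R : realType) (k : scalar_kind).
Variable X : lmodType (scalar_field R k).
Implicit Types (f g : X -> R) (B : set (X -> R)) (a : scalar_field R k).

Record is_norm f : Prop := IsNorm {
  is_norm_ge0 : forall x, 0 <= f x;
  is_norm_eq0 : forall x, f x = 0 <-> x = 0;
  is_normZ : forall a x, f (a *: x) = modulus a * f x;
  is_normD : forall x y, f (x + y) <= f x + f y }.

Definition zero_fun : X -> R := fun=> 0.

Definition norm_cone : set (X -> R) := [set f | is_norm f \/ f = zero_fun].

(* If X is the zero space then [zero_fun] is itself a norm; it is removed here
   as well, leaving the empty set. *)
Definition norm_cone_nz : set (X -> R) := norm_cone `\ zero_fun.

Definition scale_fun a f : X -> R := fun x => modulus a * f x.

Definition le_fun f g : Prop := forall x, f x <= g x.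

Definition upper_cone f : set (X -> R) :=
  [set g | norm_cone g /\ exists a, a != 0 /\ le_fun (scale_fun a f) g].

Definition orderly_independent_pair f g : Prop :=
  ~ upper_cone g f /\ ~ upper_cone f g.

Definition orderly_independent B : Prop :=
  forall f g, B f -> B g -> f <> g -> orderly_independent_pair f g.

Definition is_generator B : Prop :=
  B `<=` norm_cone_nz /\ norm_cone_nz = \bigcup_(f in B) upper_cone f.

Definition is_basis B : Prop := is_generator B /\ orderly_independent B.

End NormCone.

(* Main.v *)
(* All norms on a finite dimensional space are equivalent, so the upper cone of
   any single norm contains every other norm, and a singleton is a basis (the
   empty set is one when the space is zero). Equivalence is proved in real
   coordinates: a norm on R^n is Lipschitz for the sup norm, hence attains a
   positive minimum on the compact unit sphere. *)

Require Import Defs.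
From mathcomp Require Import all_boot all_order all_algebra.
From mathcomp Require Import complex.
From mathcomp Require Import all_classical all_reals.
From mathcomp Require Import topology normedtype derive.

Set Implicit Arguments.
Unset Strict Implicit.
Unset Printing Implicit Defensive.

Import Order.TTheory GRing.Theory Num.Theory.
Import VectorInternalTheory numFieldNormedType.Exports.

Local Open Scope classical_set_scope.
Local Open Scope ring_scope.

Section NormsOnRowVectors.
Variables (R : realType) (n : nat) (N : 'rV[R]_n -> R).
Hypothesis N_ge0 : forall v, 0 <= N v.
Hypothesis N_eq0 : forall v, N v = 0 -> v = 0.
Hypothesis NZ : forall a v, N (a *: v) = `|a| * N v.
Hypothesis ND : forall v w, N (v + w) <= N v + N w.

Lemma le_coord_norm (v : 'rV[R]_n) i : `|v 0 i| <= `|v|.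
Proof.
rewrite [leRHS]/Num.norm /= mx_normrE.
by apply/bigmax_geP; right; exists (0, i).
Qed.

Lemma rV_norm_le_sup : exists2 C, 0 < C & forall v, N v <= C * `|v|.
Proof.
(* The summand 1 keeps the constant positive even when the sum is empty, as for [n = 0]. *)
exists (1 + \sum_j N (delta_mx 0 j)) => [|v].
  by rewrite ltr_pwDl ?ltr01// sumr_ge0.
have N0 : N 0 = 0 by rewrite -(scale0r 0) NZ normr0 mul0r.
have: N v <= \sum_j N (v 0 j *: delta_mx 0 j).
  rewrite [in leLHS](row_sum_delta v).
  elim/big_ind2 : _ => [|x a y b xa yb|//]; first by rewrite N0.
  exact: le_trans (ND _ _) (lerD xa yb).
move=> /le_trans; apply; rewrite mulrDl mul1r -[leLHS]add0r lerD//.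
rewrite mulr_suml ler_sum// => j _.
by rewrite NZ mulrC ler_wpM2l// le_coord_norm.
Qed.

Lemma rV_norm_continuous : continuous N.
Proof.
have [C C_gt0 NC] := rV_norm_le_sup.
(* Reverse triangle inequality; applied to [(v, w)] and to [(w, v)] it bounds the absolute value of
   the difference. *)
have NB v w : N v - N w <= C * `|v - w|.
  rewrite lerBlDr (le_trans _ (lerD (NC _) (lexx _)))//.
  by rewrite -{1}(subrK w v) ND.
move=> v; apply/(cvgrPdist_lt (F := nbhs v)) => e e_gt0; near=> w.
have vw : C * `|v - w| < e.
  rewrite mulrC -ltr_pdivlMr//; near: w.
  have := nbhsx_ballx v (e / C) (divr_gt0 e_gt0 C_gt0).
  by rewrite -ball_normE.
rewrite ltr_norml ltrNl opprB (le_lt_trans (NB _ _))/=; first last.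
  by rewrite distrC.
by rewrite (le_lt_trans (NB _ _)).
Unshelve. all: end_near. Qed.

Lemma rV_norm_ge_sup : exists2 c, 0 < c & forall v, c * `|v| <= N v.
Proof.
pose S := [set v : 'rV[R]_n | `|v| = 1].
have normalize v : v != 0 -> S (`|v|^-1 *: v).
  by move=> v0; rewrite /S/= normrZ normfV normr_id mulVf// normr_eq0.
(* Without a nonzero vector the unit sphere is empty and has no minimum, but then any constant
   works. *)
have [[w w0]|triv] := pselect (exists w : 'rV[R]_n, w != 0); last first.
  exists 1 => // v; have [->|v0] := eqVneq v 0; first by rewrite normr0 mulr0.
  by case: triv; exists v.
have S0 : S !=set0 by exists (`|w|^-1 *: w); exact: normalize.
have compactS : compact S.
  apply: bounded_closed_compact.
    by exists 1; split=> // M /ltW M1 v /= ->.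
  rewrite (_ : S = Num.norm @^-1` [set 1])//.
  by apply: preimage_closed; [move=> v _; exact: norm_continuous|exact: closed_eq].
have [u /set_mem Su minu] :=
  EVT_min_rV S0 compactS (continuous_subspaceT rV_norm_continuous).
(* The constant is the minimum of [N] on the sphere; homogeneity carries the bound from the
   normalized vector to [v]. *)
exists (N u) => [|v].
  rewrite lt_neqAle N_ge0 andbT eq_sym; apply/eqP => /N_eq0 u0.
  by move: Su; rewrite /S/= u0 normr0 => /eqP; rewrite eq_sym oner_eq0.
have [->|v0] := eqVneq v 0; first by rewrite normr0 mulr0.
have := minu _ (mem_set (normalize v v0)).
by rewrite NZ normfV normr_id mulrC ler_pdivlMr ?normr_gt0.
Qed.

End NormsOnRowVectors.

Section Modulus.
Variables (R : realType) (k : scalar_kind).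
Implicit Types a b : scalar_field R k.

Lemma modulus_ge0 a : 0 <= modulus a.
Proof. by case: k a => a; [exact: normr_ge0|case: a => x y; exact: sqrtr_ge0]. Qed.

Lemma modulus0 : modulus (0 : scalar_field R k) = 0.
Proof. by case: k; [exact: normr0|exact: Normc.normc0]. Qed.

Lemma modulus_eq0 a : modulus a = 0 -> a = 0.
Proof. by case: k a => a; [exact: normr0_eq0|exact: Normc.eq0_normc]. Qed.

Lemma modulusM a b : modulus (a * b) = modulus a * modulus b.
Proof. by case: k a b => a b; [exact: normrM|exact: Normc.normcM]. Qed.

Lemma modulusD a b : modulus (a + b) <= modulus a + modulus b.
Proof. by case: k a b => a b; [exact: ler_normD|exact: le_normcD]. Qed.

Definition real_scalar : R -> scalar_field R k :=
  match k return R -> scalar_field R k with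
  | RealScalars => fun r => r
  | ComplexScalars => fun r => r%:C%C
  end.

Lemma modulus_real_scalar r : modulus (real_scalar r) = `|r|.
Proof. by rewrite /real_scalar; case: k => //=; rewrite expr0n addr0 sqrtr_sqr. Qed.

End Modulus.

Section Norms.
Variables (R : realType) (k : scalar_kind) (X : vectType (scalar_field R k)).
Implicit Types f g : X -> R.

(** The l1 norm of the coordinates: it shows that [X] carries a norm, and it will be the sole basis
    element when [X] is nonzero. *)
Lemma coordinate_norm :
  is_norm (fun x : X => \sum_i modulus (v2r x 0 i)).
Proof.
split=> [x|x|a x|x y].
- by apply: sumr_ge0 => i _; exact: modulus_ge0.
- split=> [x0|->]; last first.
    by rewrite big1// => i _; rewrite linear0 mxE modulus0.
  apply: v2r_inj; rewrite linear0; apply/rowP => i; rewrite mxE.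
  apply: modulus_eq0; move/eqP: x0; rewrite psumr_eq0 => [/allP/(_ i)|j _].
    by rewrite mem_index_enum => /(_ isT)/eqP.
  exact: modulus_ge0.
- by rewrite mulr_sumr; apply: eq_bigr => i _; rewrite linearZ mxE modulusM.
- rewrite -big_split ler_sum// => i _.
  by rewrite linearD mxE modulusD.
Qed.

(** Reduces both scalar fields to real row vectors: a complex space of dimension [n] is a real one
    of dimension [n + n]. Real linearity is spelled out through [real_scalar], since [X] is a module
    over [scalar_field R k] only. *)
Lemma real_coordinates : exists m (phi : 'rV[R]_m -> X),
  [/\ {morph phi : v w / v + w},
      forall r v, phi (r *: v) = real_scalar k r *: phi v,
      injective phi & forall x, exists v, phi v = x].
Proof.
case: k X => V.
  exists (dim V), (fun v => r2v v : V); split=> [v w|r v||x].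
  - exact: linearD.
  - exact: linearZ.
  - exact: r2v_inj.
  - by exists (v2r x); exact: v2rK.
pose n := dim V.
(* The first [n] entries hold the real parts, the last [n] the imaginary parts. *)
pose row (v : 'rV[R]_(n + n)) : 'rV[scalar_field R ComplexScalars]_n :=
  \row_j (lsubmx v 0 j +i* rsubmx v 0 j)%C.
exists (n + n), (fun v => @r2v _ V (row v)); split=> [v w|r v|v w|x].
- rewrite -linearD; congr r2v; apply/rowP => j.
  by rewrite !mxE.
- rewrite -linearZ; congr r2v; apply/rowP => j.
  by rewrite !mxE; apply/eqP; rewrite eq_complex /= !mul0r subr0 addr0 !eqxx.
- move=> /r2v_inj/rowP vw.
  rewrite -[v]hsubmxK -[w]hsubmxK.
  by congr row_mx; apply/rowP => j; have := vw j; rewrite ![row _ _ _]mxE => -[].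
- exists (row_mx (\row_j complex.Re (v2r x 0 j)) (\row_j complex.Im (v2r x 0 j))).
  rewrite -[RHS]v2rK; congr r2v; apply/rowP => j.
  by rewrite mxE row_mxKl row_mxKr !mxE; case: (v2r x 0 j).
Qed.

Lemma norm_equiv f g : is_norm f -> is_norm g ->
  exists2 c, 0 < c & forall x, c * f x <= g x.
Proof.
have [m [phi [phiD phiZ phi_inj phi_surj]]] := real_coordinates.
have phi0 : phi 0 = 0 by apply: (addrI (phi 0)); rewrite -phiD !addr0.
(* Pulled back along [phi], a norm on [X] becomes a norm on real row vectors; injectivity of [phi]
   gives definiteness. *)
have pull h : is_norm h -> [/\ forall v, 0 <= h (phi v),
    forall v, h (phi v) = 0 -> v = 0,
    forall r v, h (phi (r *: v)) = `|r| * h (phi v) &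
    forall v w, h (phi (v + w)) <= h (phi v) + h (phi w)].
  case=> h_ge0 h_eq0 hZ hD; split=> // [v|r v|v w].
  - by move=> /h_eq0; rewrite -phi0 => /phi_inj.
  - by rewrite phiZ hZ modulus_real_scalar.
  - by rewrite phiD.
move=> /pull[f_ge0 _ fZ fD] /pull[g_ge0 g_eq0 gZ gD].
have [C C_gt0 fC] := rV_norm_le_sup f_ge0 fZ fD.
have [c c_gt0 cg] := rV_norm_ge_sup g_ge0 g_eq0 gZ gD.
(* In coordinates, [f] is at most [C] times the sup norm and [g] at least [c] times it. *)
exists (c / C) => [|x]; first by rewrite divr_gt0.
have [v <-] := phi_surj x.
rewrite (le_trans _ (cg v))// -mulrA ler_pM2l// mulrC ler_pdivrMr//.
by rewrite mulrC.
Qed.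

Lemma upper_cone_norm f g : is_norm f -> is_norm g -> upper_cone f g.
Proof.
move=> fn gn; split; first by left.
have [c c_gt0 cfg] := norm_equiv fn gn.
exists (real_scalar k c); split=> [|x].
  apply: contraTneq c_gt0 => c0.
  have /normr0_eq0-> : `|c| = 0 by rewrite -(modulus_real_scalar k) c0 modulus0.
  by rewrite ltxx.
by rewrite /scale_fun modulus_real_scalar gtr0_norm.
Qed.

End Norms.

Theorem theorem6p2 (R : realType) (k : scalar_kind)
    (X : vectType (scalar_field R k)) :
  exists B : set (X -> R), is_basis B.
Proof.
have := coordinate_norm X; set f := (fun x : X => _) => f_norm.
have [f0|f0] := pselect (f = @zero_fun R k X).
  (* Here a norm vanishes identically, so X is the zero space. *)
  exists set0; split; last by [].
  split=> //; rewrite bigcup_set0 -subset0 => g [[gn|//] gnz].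
  apply: gnz; apply/funext => x; apply/(is_norm_eq0 gn).
  by apply/(is_norm_eq0 f_norm); rewrite f0.
exists [set f]; split; last by move=> g h -> ->.
split=> [_ ->|]; first by split=> //; left.
rewrite bigcup_set1; apply/seteqP; split=> [g [[gn|//] _]|g [gc [a [a0 fg]]]].
  exact: upper_cone_norm.
(* The zero function is not in the cone of [f]: [modulus a * f x <= 0] with [modulus a > 0] would
   make [f] vanish. *)
split=> //= g0; apply: f0; apply/funext => x; apply/eqP.
rewrite eq_le (is_norm_ge0 f_norm) andbT /zero_fun.
have := fg x; rewrite g0 /scale_fun /zero_fun pmulr_rle0//.
rewrite lt_neqAle modulus_ge0 andbT eq_sym.
by apply: contraNneq a0 => /modulus_eq0 ->.
Qed.
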